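(* Let $n,m>10$ be integers. Then $$a_2(K_{n,m})\ge 0.278\cdot\min\{n,m\}-2.78,$$ and $$a_3(K_{n,m})\ge 0.0618\cdot\min\{n,m\}-0.618.$$
   Context: $K_{n,m}$ is the complete bipartite graph with sides of size $n$ and $m$. Let $d\ge1$. For a finite simple graph $G=(V,E)$ with $|V|\ge d+1$ and $p:V\to\mathbb{R}^d$, for $u,v\in V$ put $d_{uv}=\frac{p(u)-p(v)}{\|p(u)-p(v)\|}$ if $p(u)\neq p(v)$ and $d_{uv}=0$ otherwise. The rigidity matrix $R(G,p)\in\mathbb{R}^{d|V|\times|E|}$ has rows indexed by pairs $(u,i)$, $u\in V$, $1\le i\le d$, columns indexed by edges, and entries $R(G,p)_{(u,i),e}=(d_{uv})_i$ if $e=\{u,v\}$ for some $v\in V$, and $0$ if $u\notin e$. The stiffness matrix is $L(G,p)=R(G,p)R(G,p)^{\top}$. Let $\lambda_k(M)$ denote the $k$-th smallest eigenvalue (with multiplicity) of a symmetric matrix $M$. The $d$-dimensional algebraic connectivity of $G$ is $$a_d(G)=\sup\left\{\lambda_{\binom{d+1}{2}+1}(L(G,p))\ :\ p:V\to\mathbb{R}^d\right\}.$$ *)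

(* Defs.v *)
From HB Require Import structures.
From mathcomp Require Import all_boot all_order all_algebra.
From mathcomp Require Import complex.
From mathcomp Require Import boolp classical_sets reals.

Set Implicit Arguments.
Unset Strict Implicit.
Unset Printing Implicit Defensive.

Import Order.TTheory GRing.Theory Num.Theory.
Local Open Scope ring_scope.

Record sgraph (V : finType) := SGraph {
  adj :> rel V;
  adj_sym : symmetric adj;
  adj_irr : irreflexive adj }.

Definition edges (V : finType) (G : sgraph V) : {set {set V}} :=
  [set [set u; v] | u in V, v in V & G u v].

Definition bip_adj (n m : nat) : rel ('I_n + 'I_m)%type := fun x y =>
  match x, y with
  | inl _, inr _ | inr _, inl _ => true
  | _, _ => false
  end.

Fact bip_adj_sym n m : symmetric (@bip_adj n m).
Proof. by case=> ? []. Qed.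

Fact bip_adj_irr n m : irreflexive (@bip_adj n m).
Proof. by case. Qed.

Definition complete_bipartite (n m : nat) : sgraph ('I_n + 'I_m)%type :=
  SGraph (@bip_adj_sym n m) (@bip_adj_irr n m).

(* The library norm `|x| on row vectors is the sup norm, hence this one. *)
Definition enorm (R : realType) (d : nat) (x : 'rV[R]_d) : R :=
  Num.sqrt (\sum_(i < d) x 0 i ^+ 2).

Definition direction (R : realType) (d : nat) (V : finType)
    (p : V -> 'rV[R]_d) (u v : V) : 'rV[R]_d :=
  if p u == p v then 0 else (enorm (p u - p v))^-1 *: (p u - p v).

(* Rows are numbered through V * 'I_d and columns through the edge set, by
   the canonical enumerations. An edge e = {u, v} is never a singleton, so
   the endpoint v picked below is unique and distinct from u. *)
Definition rigidity_mx (R : realType) (d : nat) (V : finType) (G : sgraph V)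
    (p : V -> 'rV[R]_d) : 'M[R]_(#|{: V * 'I_d}|, #|edges G|) :=
  \matrix_(r, c)
    let: (u, i) := enum_val r in
    if [pick v | enum_val c == [set u; v]] is Some v
    then direction p u v 0 i else 0.

Definition stiffness_mx (R : realType) (d : nat) (V : finType) (G : sgraph V)
    (p : V -> 'rV[R]_d) : 'M[R]_#|{: V * 'I_d}| :=
  rigidity_mx G p *m (rigidity_mx G p)^T.

Definition is_spectrum (R : realType) (n : nat) (A : 'M[R]_n) (s : seq R) :=
  sorted <=%R s /\ char_poly A = \prod_(x <- s) ('X - x%:P).

(* Eigenvalues with multiplicity, in nondecreasing order. The value is
   meaningful when char_poly A splits over R, in particular for symmetric A
   (see symmetric_spectrum). *)
Definition spectrum (R : realType) (n : nat) (A : 'M[R]_n) : seq R :=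
  xget [::] [set s | is_spectrum A s]%classic.

(* k is counted from 1: lambda 1 A is the smallest eigenvalue. *)
Definition lambda (R : realType) (k n : nat) (A : 'M[R]_n) : R :=
  nth 0 (spectrum A) k.-1.

Lemma is_spectrum_uniq (R : realType) n (A : 'M[R]_n) s t :
  is_spectrum A s -> is_spectrum A t -> s = t.
Proof.
move=> [ss es] [st et]; apply: (sorted_eq le_trans le_anti ss st).
by apply: prod_XsubC_eq; rewrite -es -et.
Qed.

Lemma symmetric_spectrum (R : realType) n (A : 'M[R]_n) :
  A^T = A -> is_spectrum A (spectrum A) /\ size (spectrum A) = n.
Proof.
move=> symA; suff [s As] : exists s, is_spectrum A s.
  have As' : is_spectrum A (spectrum A) by exact: (xgetPex [::] (ex_intro _ s As)).
  split=> //; have := size_char_poly A.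
  by rewrite As'.2 size_prod_XsubC => -[].
pose f := real_complex R; pose B := map_mx f A.
have hB : B \is hermsymmx.
  apply: realsym_hermsym.
    apply/is_hermitianmxP; rewrite expr0 scale1r map_mx_id //.
    by apply/matrixP=> i j; rewrite !mxE -{1}symA mxE.
  by apply/mxOverP=> i j; rewrite mxE; apply/complex_realP; exists (A i j).
have /orthomx_spectralP := hermitian_normalmx hB.
have /mxOverP Dreal := hermitian_spectral_diag_real hB.
have := spectral_unit B.
set P := spectralmx B; set D := spectral_diag B in Dreal * => Pu BE.
have cB : char_poly B = \prod_(i < n) ('X - (D 0 i)%:P).
  pose PC := map_mx (@polyC R[i]) P; pose PV := map_mx (@polyC R[i]) (invmx P).
  have PVP : PV *m PC = 1%:M by rewrite -map_mxM mulVmx // map_mx1.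
  have -> : char_poly B = char_poly (diag_mx D).
    rewrite /char_poly.
    have -> : char_poly_mx B = PV *m char_poly_mx (diag_mx D) *m PC.
      rewrite /char_poly_mx mulmxBr mulmxBl {1}BE !map_mxM; congr (_ - _).
      by rewrite scalar_mxC -mulmxA PVP mulmx1.
    by rewrite !det_mulmx mulrAC -det_mulmx PVP det1 mul1r.
  rewrite char_poly_trig ?diag_mx_is_trig //.
  by apply: eq_bigr => i _; rewrite mxE eqxx mulr1n.
pose t := [seq complex.Re (D 0 i) | i <- enum 'I_n].
exists (sort <=%R t); split; first exact: (sort_sorted le_total).
rewrite (perm_big t) ?perm_sort //=; apply: (@map_poly_inj _ _ f).
rewrite map_char_poly -/B cB rmorph_prod big_map big_enum /=.
apply: eq_bigr => i _; rewrite rmorphB /= map_polyX map_polyC /=.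
by rewrite /f RRe_real.
Qed.

(* This is a genuine supremum: stiffness_mx G p is positive semidefinite with
   trace at most 2 * #|edges G|, which bounds all its eigenvalues. *)
Definition alg_connectivity (R : realType) (d : nat) (V : finType)
    (G : sgraph V) : R :=
  sup [set lambda ('C(d.+1, 2)).+1 (stiffness_mx G p) | p in
       [set: V -> 'rV[R]_d]]%classic.

(* Main.v *)
From Stdlib Require Import ZArith.
Require Import Defs.
From mathcomp Require Import all_boot all_order all_algebra.
From mathcomp Require Import complex.
From mathcomp Require Import boolp classical_sets reals.
From mathcomp Require Import ssrZ zify ring lra.

(** Send every vertex of K_{n,m} to its residue modulo 6 and place all the
    vertices of a residue class at one point, so that a fixed framework on
    K_{6,6} is blown up.  Write a displacement of the vertices as its class
    means plus the deviations from them.  The stiffness form splits along this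
    decomposition ([sum_stretch]): the means see the form of the K_{6,6}
    framework, each bar counted with the product of the sizes of its two
    classes, and a deviation in a class sees the sum of the squared projections
    onto the bars at that site.  If both forms are bounded below by a constant
    c0 in the K_{6,6} framework, the first one on the orthogonal complement of
    the infinitesimal isometries, then the blown-up form is bounded below by a
    constant c on the displacements whose class means lie in that complement
    ([blowup_stretch]).  This subspace is cut out by binom(d+1,2) linear
    equations, so by Courant-Fischer ([lambda_ge_codim]) the eigenvalue that
    defines a_d is at least c.

    The slack of ten vertices in the statement pays for class sizes that are
    not all equal.  If n = 6q + r with 0 <= r <= 5, the classes on that side
    have q or q + 1 elements, and when q is also the smaller quotient the bound
    is essentially c0 q^2 / (q + 1).  To beat t (6q + 5 - 10) it suffices that
    c0 >= t (6 + u - 5 u^2) with u = 1/q, a parabola whose maximum is 6.05 t,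
    reached at u = 1/10 ([rounding_budget]).

    It remains to exhibit frameworks on K_{6,6} with c0 = 6.05 * 0.278 in the
    plane and c0 = 6.05 * 0.0618 in space.  Their sites have integer
    coordinates; the square of the projection onto a bar is then a rational
    quadratic form although the unit direction is irrational, and positivity is
    decided by Gaussian elimination on integer matrices in which quotients are
    rounded down and the diagonal is lowered to pay for the rounding
    ([eliminates]). *)

Set Implicit Arguments.
Unset Strict Implicit.
Unset Printing Implicit Defensive.

Import Order.TTheory GRing.Theory Num.Theory.
Local Open Scope ring_scope.

(** * Variational bounds for the eigenvalues of a symmetric matrix *)

Section Spectrum.
Variable R : realType.
Local Open Scope sesquilinear_scope.
Local Notation f := (real_complex R).

Lemma char_poly_conj (F : fieldType) N (P A : 'M[F]_N) :
  P \in unitmx -> char_poly (invmx P *m A *m P) = char_poly A.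
Proof.
move=> Pu; pose PC := map_mx (@polyC F) P; pose PV := map_mx (@polyC F) (invmx P).
have PVP : PV *m PC = 1%:M by rewrite -map_mxM mulVmx // map_mx1.
have -> : char_poly (invmx P *m A *m P) = \det (PV *m char_poly_mx A *m PC).
  rewrite /char_poly /char_poly_mx mulmxBr mulmxBl !map_mxM; congr (\det (_ - _)).
  by rewrite scalar_mxC -mulmxA PVP mulmx1.
by rewrite !det_mulmx mulrAC -det_mulmx PVP det1 mul1r.
Qed.

(** The spectral theorem is used over the complex numbers, where unitary
    diagonalization is known; the eigenvalues of a real symmetric matrix are
    nevertheless the real numbers collected in [spectrum]. *)
Lemma symmetric_diagonalization N (A : 'M[R]_N) : A^T = A ->
  exists (P : 'M[R[i]]_N) (D : 'rV[R]_N), [/\ P \is unitarymx,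
    map_mx f A = invmx P *m diag_mx (map_mx f D) *m P &
    perm_eq (spectrum A) [seq D 0 i | i <- enum 'I_N]].
Proof.
move=> symA; pose B := map_mx f A.
have hB : B \is hermsymmx.
  apply: realsym_hermsym.
    apply/is_hermitianmxP; rewrite expr0 scale1r map_mx_id //.
    by rewrite /B map_trmx symA.
  by apply/mxOverP=> i j; rewrite mxE; apply/complex_realP; exists (A i j).
have /orthomx_spectralP := hermitian_normalmx hB.
have /mxOverP Dreal := hermitian_spectral_diag_real hB.
have := spectral_unitarymx B.
set P := spectralmx B; set D := spectral_diag B in Dreal * => PU BE.
have DE : D = map_mx f (map_mx (@complex.Re R) D).
  by apply/matrixP=> i j; rewrite !mxE -[LHS](RRe_real (Dreal i j)).
exists P, (map_mx (@complex.Re R) D); split; rewrite -?DE //.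
apply: (@perm_map_inj _ _ f); first by move=> x y [].
apply: prod_XsubC_eq; rewrite !big_map.
have [[_ cA] _] := symmetric_spectrum symA.
have -> : \prod_(x <- spectrum A) ('X - (f x)%:P) = char_poly B.
  rewrite -map_char_poly cA rmorph_prod; apply: eq_bigr => x _.
  by rewrite rmorphB /= map_polyX map_polyC.
rewrite BE char_poly_conj ?unitarymx_unit //.
rewrite char_poly_trig ?diag_mx_is_trig // -enumT big_enum.
by apply: eq_bigr => i _; rewrite [in LHS]DE !mxE eqxx mulr1n.
Qed.

(** One half of the Courant-Fischer principle.  If lambda_{k+1} < c, the
    eigenvectors with eigenvalue below c span more than k dimensions, hence
    some nonzero combination v of them satisfies the k equations v *m C = 0,
    and its Rayleigh quotient is below c.  Since v is complex, the hypothesis is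
    applied to its real and imaginary parts separately. *)
Lemma lambda_ge_codim N k (A : 'M[R]_N) (C : 'M[R]_(N, k)) c :
  A^T = A -> (k < N)%N ->
  (forall v : 'rV_N, v *m C = 0 ->
     c * (v *m v^T) 0 0 <= (v *m A *m v^T) 0 0) ->
  c <= lambda k.+1 A.
Proof.
move=> symA ltkN Ac; rewrite /lambda /=; rewrite leNgt; apply/negP => ltc.
have [[ss _] sz] := symmetric_spectrum symA.
have [P [D [PU AE permD]]] := symmetric_diagonalization symA.
pose S := [set i | D 0 i < c].
have ltkS : (k < #|S|)%N.
  have -> : #|S| = count (fun x => x < c) (spectrum A).
    rewrite -sum1_count (perm_big _ permD) big_map big_enum_cond sum1_card.
    by apply: eq_card => i; rewrite !inE.
  rewrite -(cat_take_drop k.+1 (spectrum A)) count_cat.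
  apply: leq_trans (leq_addr _ _).
  suff /eqP -> : count (fun x => x < c) (take k.+1 (spectrum A))
      == size (take k.+1 (spectrum A)) by rewrite size_takel ?sz.
  rewrite -all_count; apply/(all_nthP 0) => i.
  rewrite size_takel ?sz // => ik; rewrite nth_take //.
  apply: le_lt_trans ltc; apply: (sorted_leq_nth le_trans le_refl) => //.
  - by rewrite inE sz (leq_trans ik).
  - by rewrite inE sz.
(* The rows of E *m P are the eigenvectors with eigenvalue below c. *)
pose E := rowsub (@enum_val _ (mem S)) (1%:M : 'M[R[i]]_N).
have [u uE u0] : exists2 u : 'rV[R[i]]_#|S|,
    u *m (E *m P *m map_mx f C) = 0 & u != 0.
  have : kermx (E *m P *m map_mx f C) != 0.
    rewrite kermx_eq0 /row_free; apply: contraTneq ltkS => <-.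
    by rewrite -leqNgt rank_leq_col.
  case/rowV0Pn => u uK u0; exists u => //; exact: sub_kermxP.
pose w := u *m E; pose v := w *m P.
have wE i : w 0 i = \sum_(j | enum_val j == i) u 0 j.
  rewrite mxE [RHS]big_mkcond; apply: eq_bigr => j _; rewrite !mxE.
  by case: eqP; rewrite ?mulr1 ?mulr0.
have w0 i : i \notin S -> w 0 i = 0.
  move=> iS; rewrite wE big_pred0 // => j; apply/eqP => ji.
  by rewrite -ji enum_valP in iS.
have wv j : w 0 (enum_val j) = u 0 j.
  by rewrite wE (big_pred1 j) // => l; rewrite (inj_eq enum_val_inj).
pose a := map_mx (@complex.Re R) v; pose b := map_mx (@complex.Im R) v.
have vab M (X : 'M[R]_(N, M)) (i : 'I_1) j :
    (v *m map_mx f X) i j = ((a *m X) i j +i* (b *m X) i j)%C.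
  rewrite !mxE (eq_bigr (fun k => (a i k * X k j)%:C + 'i * (b i k * X k j)%:C)%C).
    by rewrite big_split /= -mulr_sumr -!raddf_sum /=; simpc.
  by move=> l _; rewrite [map_mx f X _ _]mxE [a _ _]mxE [b _ _]mxE;
    case: (v i l) => x y /=; simpc.
have vC : v *m map_mx f C = 0 by rewrite /v /w -!mulmxA; rewrite -!mulmxA in uE.
have aC : a *m C = 0.
  by apply/matrixP => i j; have := vab _ C i j; rewrite vC !mxE => -[].
have bC : b *m C = 0.
  by apply/matrixP => i j; have := vab _ C i j; rewrite vC !mxE => -[].
have Q (X : 'M[R]_N) : complex.Re ((v *m map_mx f X *m v^t*) 0 0) =
    (a *m X *m a^T) 0 0 + (b *m X *m b^T) 0 0.
  rewrite ![(_ *m _^T) _ _]mxE [(_ *m v^t*) _ _]mxE raddf_sum -big_split /=.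
  apply: eq_bigr => j _; rewrite vab [v^t* _ _]mxE ![_^T _ _]mxE [a _ _]mxE [b _ _]mxE.
  by case: (v 0 j) => x y /=; ring.
have vA : (v *m map_mx f A *m v^t*) 0 0 = \sum_i f (D 0 i) * `|w 0 i| ^+ 2.
  rewrite AE /v trmx_mul map_mxM /= !mulmxA mulmxtVK // invmx_unitary //.
  rewrite mulmxtVK // mxE; apply: eq_bigr => i _.
  by rewrite mul_mx_diag !mxE normCK mulrAC mulrC mulrA.
have v1 : (v *m map_mx f 1%:M *m v^t*) 0 0 = \sum_i `|w 0 i| ^+ 2.
  rewrite map_mx1 mulmx1 /v trmx_mul map_mxM /= !mulmxA mulmxtVK // mxE.
  by apply: eq_bigr => i _; rewrite !mxE normCK.
have := lerD (Ac _ aC) (Ac _ bC); rewrite -Q vA -mulrDr.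
have := Q 1%:M; rewrite v1 !mulmx1 => <-.
have [j uj] : exists j, u 0 j != 0.
  apply/existsP; rewrite -negb_forall; apply: contra_neqN u0 => /forallP u0.
  by apply/rowP => j; rewrite mxE; apply/eqP.
rewrite !raddf_sum mulr_sumr leNgt => /negP; apply.
have nE i : complex.Re (f (D 0 i) * `|w 0 i| ^+ 2) = D 0 i * complex.Re (`|w 0 i| ^+ 2).
  by case: (`|w 0 i| ^+ 2) => x y; simpc.
have n0 i : 0 <= complex.Re (`|w 0 i| ^+ 2).
  have : 0 <= `|w 0 i| ^+ 2 by rewrite exprn_ge0.
  by rewrite lecE => /andP[].
have nj : 0 < complex.Re (`|w 0 (enum_val j)| ^+ 2).
  have : 0 < `|w 0 (enum_val j)| ^+ 2 by rewrite exprn_gt0 // normr_gt0 wv.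
  by rewrite ltcE => /andP[].
have Sj : D 0 (enum_val j) < c by have := enum_valP j; rewrite inE.
rewrite (bigD1 (enum_val j)) // [ltRHS](bigD1 (enum_val j)) //.
apply: ltr_leD; first by have := Sj; rewrite -(ltr_pM2r nj) -nE.
apply: ler_sum => i _; suff : D 0 i * complex.Re (`|w 0 i| ^+ 2) <=
  c * complex.Re (`|w 0 i| ^+ 2) by rewrite -nE.
have [iS|iS] := boolP (i \in S).
  by apply: ler_wpM2r => //; rewrite inE in iS; apply: ltW.
by rewrite w0 // normr0 expr0n /= !mulr0.
Qed.

(** Compare the entries of both sides of v *m A = l *: v at an index where |v|
    is largest.  This crude bound serves to make the supremum in the definition
    of the algebraic connectivity a genuine one. *)
Lemma lambda_le_entries N k (A : 'M[R]_N) M :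
  A^T = A -> (k < N)%N -> (forall i j, `|A i j| <= M) ->
  lambda k.+1 A <= N%:R * M.
Proof.
move=> symA ltkN AM; rewrite /lambda /=.
have [[_ cA] sz] := symmetric_spectrum symA.
set l := nth _ _ _.
have : root (char_poly A) l by rewrite cA root_prod_XsubC mem_nth ?sz.
rewrite -eigenvalue_root_char => /eigenvalueP[v vA v0].
have [i _ imax] : exists2 i, true & forall j, `|v 0 j| <= `|v 0 i|.
  pose i := [arg max_(i > Ordinal ltkN) `|v 0 i|]%O.
  by exists i => // j; rewrite /i; case: arg_maxP => // ? _; apply.
have vi : 0 < `|v 0 i|.
  rewrite normr_gt0; apply: contra_neqN v0 => /eqP vi.
  apply/rowP => j; apply/eqP; rewrite mxE -normr_le0.
  by rewrite (le_trans (imax j)) // vi normr0.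
rewrite -(ler_pM2r vi) (le_trans (ler_norm _)) // normrM normr_id -normrM.
have -> : l * v 0 i = (v *m A) 0 i by rewrite vA mxE.
rewrite mxE (le_trans (ler_norm_sum _ _ _)) // -mulrA.
rewrite mulr_natl -[X in _ *+ X]card_ord -sumr_const; apply: ler_sum => j _.
by rewrite normrM mulrC ler_pM.
Qed.
End Spectrum.

(** * The stiffness form of a framework on a complete bipartite graph *)

Definition dotv (R : pzRingType) d (u v : 'rV[R]_d) : R :=
  \sum_(i < d) u 0 i * v 0 i.

Section Form.
Variables (R : realType) (d n m : nat).
Local Notation V := ('I_n + 'I_m)%type.
Implicit Types (p x : V -> 'rV[R]_d).

Definition biedge (ab : 'I_n * 'I_m) : {set V} := [set inl ab.1; inr ab.2].

Lemma biedge_inj : injective biedge.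
Proof.
move=> [a b] [a' b'] /setP E.
have /esym := E (inl a); rewrite !inE eqxx /= orbF => /eqP[->].
by have /esym := E (inr b); rewrite !inE eqxx /= => /eqP[->].
Qed.

Lemma edges_bipartite : edges (complete_bipartite n m) = biedge @: setT.
Proof.
apply/setP => e; apply/imset2P/imsetP.
- case=> -[a|b] -[a'|b'] _; rewrite inE //= => _ ->.
    by exists (a, b'); rewrite ?inE.
  by exists (a', b); rewrite ?inE // finset.setUC.
- case=> -[a b] _ ->; exists (inl a) (inr b) => //; by rewrite inE.
Qed.

Lemma pick_biedge (a : 'I_n) (b : 'I_m) (u : V) :
  [pick v | biedge (a, b) == [set u; v]] =
  if u == inl a then Some (inr b) else if u == inr b then Some (inl a) else None.
Proof.
case: pickP => [v /eqP/setP E|E].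
- have := E u; rewrite !inE eqxx /= => /orP[] /eqP uE; rewrite uE eqxx /=.
    by have := E (inr b); rewrite !inE eqxx uE /= => /esym/eqP <-.
  by have := E (inl a); rewrite !inE eqxx uE /= => /esym/eqP <-.
- case: eqP => [uE|_]; first by have := E (inr b); rewrite uE eqxx.
  case: eqP => [uE|_] //; have := E (inl a).
  by rewrite uE finset.setUC eqxx.
Qed.

Lemma directionC p u v : direction p v u = - direction p u v.
Proof.
rewrite /direction eq_sym; case: eqP => _; first by rewrite oppr0.
rewrite -scalerN opprB; congr (_^-1 *: _).
by rewrite /enorm; congr Num.sqrt; apply: eq_bigr => i _; rewrite !mxE -sqrrN opprB.
Qed.

(** Displacements are handled as functions from vertices to vectors; this is
    the row vector that the numbering of [rigidity_mx] attaches to one. *)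
Definition flatten_conf x : 'rV[R]_#|{: V * 'I_d}| :=
  \row_r x (enum_val r).1 0 (enum_val r).2.

Lemma flatten_sum x (F : V -> 'I_d -> R) :
  \sum_r flatten_conf x 0 r * F (enum_val r).1 (enum_val r).2 =
  \sum_u \sum_i x u 0 i * F u i.
Proof.
rewrite pair_big /= (reindex (@enum_val _ (mem {: V * 'I_d}))) /=.
  by apply: eq_big => [r|r _]; rewrite ?mxE.
exists enum_rank => r _; [exact: enum_valK | exact: enum_rankK].
Qed.

Lemma rigidity_row p x (c : 'I_#|edges (complete_bipartite n m)|) a b :
  enum_val c = biedge (a, b) ->
  (flatten_conf x *m rigidity_mx (complete_bipartite n m) p) 0 c =
  dotv (x (inl a) - x (inr b)) (direction p (inl a) (inr b)).
Proof.
move=> cE; rewrite mxE.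
pose F (u : V) i := if [pick v | biedge (a, b) == [set u; v]] is Some v
    then direction p u v 0 i else 0.
have -> : \sum_r flatten_conf x 0 r * rigidity_mx (complete_bipartite n m) p r c
    = \sum_r flatten_conf x 0 r * F (enum_val r).1 (enum_val r).2.
  by apply: eq_bigr => r _; rewrite [rigidity_mx _ _ _ _]mxE cE; case: (enum_val r).
rewrite flatten_sum (bigD1 (inl a)) //= (bigD1 (inr b)) //= [X in _ + (_ + X)]big1 ?addr0.
  rewrite -big_split; apply: eq_bigr => i _ /=; rewrite /F !pick_biedge !eqxx /=.
  by rewrite (directionC p (inl a)) !mxE mulrN mulrBl.
move=> u /andP[/negPf ua /negPf ub]; rewrite big1 // => i _.
by rewrite /F pick_biedge ua ub mulr0.
Qed.

Lemma stiffness_form p x :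
  (flatten_conf x *m stiffness_mx (complete_bipartite n m) p
     *m (flatten_conf x)^T) 0 0 =
  \sum_a \sum_b dotv (x (inl a) - x (inr b)) (direction p (inl a) (inr b)) ^+ 2.
Proof.
rewrite /stiffness_mx -!mulmxA -trmx_mul mulmxA mxE pair_big /=.
set w := _ *m _.
have -> : \sum_c w 0 c * w^T c 0 = \sum_c w 0 c ^+ 2.
  by apply: eq_bigr => c _; rewrite [w^T _ _]mxE expr2.
have h (ab : 'I_n * 'I_m) : biedge ab \in edges (complete_bipartite n m).
  by rewrite edges_bipartite imset_f ?inE.
rewrite (reindex (fun ab => enum_rank_in (h ab) (biedge ab))) /=.
  by apply: eq_bigr => -[a b] _; rewrite (@rigidity_row p x _ a b) // enum_rankK_in ?h.
have eb e : e \in edges (complete_bipartite n m) -> exists ab, e == biedge ab.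
  by rewrite edges_bipartite => /imsetP[ab _ ->]; exists ab.
exists (fun c => xchoose (eb _ (enum_valP c))).
- move=> ab _; apply: biedge_inj; apply/esym.
  by rewrite -(eqP (xchooseP (eb _ _))) enum_rankK_in ?h.
- move=> c _; apply: enum_val_inj; rewrite enum_rankK_in ?h //.
  by rewrite -(eqP (xchooseP (eb _ _))).
Qed.

Lemma flatten_surj (v : 'rV[R]_#|{: V * 'I_d}|) :
  v = flatten_conf (fun u => \row_i v 0 (enum_rank (u, i))).
Proof.
by apply/rowP => r; rewrite !mxE -surjective_pairing enum_valK.
Qed.

Lemma flatten_norm x :
  (flatten_conf x *m (flatten_conf x)^T) 0 0 = \sum_u dotv (x u) (x u).
Proof.
rewrite mxE -(flatten_sum x (fun u i => x u 0 i)).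
by apply: eq_bigr => r _; rewrite !mxE.
Qed.

Lemma direction_le1 p u v i : `|direction p u v 0 i| <= 1.
Proof.
rewrite /direction; case: eqP => [_|]; first by rewrite mxE normr0 ler01.
move=> uv; rewrite mxE normrM; set w := p u - p v.
have ew : 0 <= enorm w by apply: sqrtr_ge0.
have le : `|w 0 i| <= enorm w.
  rewrite -sqrtr_sqr ler_sqrt; last by apply: sumr_ge0 => j _; apply: sqr_ge0.
  by rewrite (bigD1 i) //= lerDl; apply: sumr_ge0 => j _; apply: sqr_ge0.
have [e0|] := eqVneq (enorm w) 0; first by rewrite e0 invr0 normr0 mul0r.
rewrite neq_lt ltNge ew /= => e0.
by rewrite normfV ger0_norm // mulrC ler_pdivrMr // mul1r.
Qed.

Lemma rigidity_le1 p r c : `|rigidity_mx (complete_bipartite n m) p r c| <= 1.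
Proof.
rewrite mxE; case: (enum_val r) => u i; case: pickP => [v _|_].
  exact: direction_le1.
by rewrite normr0 ler01.
Qed.

Lemma stiffness_sym p : (stiffness_mx (complete_bipartite n m) p)^T =
  stiffness_mx (complete_bipartite n m) p.
Proof. by rewrite /stiffness_mx trmx_mul trmxK. Qed.

Lemma card_dofs : #|{: V * 'I_d}| = ((n + m) * d)%N.
Proof. by rewrite card_prod card_sum !card_ord. Qed.

(** All that the rest of the proof needs to know about spectra: a lower bound
    for the stiffness form on the common kernel of binom(d+1,2) linear forms,
    for one placement p, bounds the algebraic connectivity. *)
Lemma alg_connectivity_ge p (T : 'I_('C(d.+1, 2)) -> V -> 'rV[R]_d) c :
  ('C(d.+1, 2) < (n + m) * d)%N ->
  (forall x, (forall j, \sum_u dotv (x u) (T j u) = 0) ->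
     c * \sum_u dotv (x u) (x u) <=
     \sum_a \sum_b dotv (x (inl a) - x (inr b)) (direction p (inl a) (inr b)) ^+ 2) ->
  c <= alg_connectivity R d (complete_bipartite n m).
Proof.
move=> dof hc; pose L := stiffness_mx (complete_bipartite n m) p.
apply: (@le_trans _ _ (lambda ('C(d.+1, 2)).+1 L)).
  pose C := \matrix_(r, j) T j (@enum_val _ (mem {: V * 'I_d}) r).1 0 (enum_val r).2.
  apply: (@lambda_ge_codim _ _ _ _ C); rewrite ?stiffness_sym ?card_dofs // => v vC.
  rewrite (flatten_surj v) in vC *; rewrite flatten_norm stiffness_form.
  apply: hc => j; have /rowP/(_ j) := vC; rewrite !mxE => E.
  rewrite -[RHS]E -(flatten_sum _ (fun u i => T j u 0 i)).
  by apply: eq_bigr => r _; rewrite !mxE.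
apply: ub_le_sup; last by exists p.
exists (#|{: V * 'I_d}|%:R * (\sum_(e < #|edges (complete_bipartite n m)|) 1)).
move=> _ [q _ <-]; apply: lambda_le_entries; rewrite ?stiffness_sym ?card_dofs // => r s.
rewrite mxE (le_trans (ler_norm_sum _ _ _)) //; apply: ler_sum => e _.
by rewrite normrM [_^T _ _]mxE mulr_ile1 // rigidity_le1.
Qed.

(** The square root in the unit direction disappears on squaring, which makes
    the stiffness form rational for sites with rational coordinates.  The
    formula includes coinciding points: both sides then vanish. *)
Lemma dotv_direction p u v (x : 'rV[R]_d) :
  dotv x (direction p u v) ^+ 2 =
  dotv x (p u - p v) ^+ 2 / dotv (p u - p v) (p u - p v).
Proof.
rewrite /direction; case: eqP => [->|_].
  rewrite subrr /dotv big1 => [|i _]; last by rewrite mxE mulr0.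
  by rewrite expr0n mul0r.
set w := p u - p v.
have -> : dotv x ((enorm w)^-1 *: w) = (enorm w)^-1 * dotv x w.
  by rewrite mulr_sumr; apply: eq_bigr => i _; rewrite mxE mulrCA.
rewrite exprMn exprVn mulrC; congr (_ / _).
rewrite sqr_sqrtr; last by apply: sumr_ge0 => j _; apply: sqr_ge0.
by apply: eq_bigr => i _; rewrite expr2.
Qed.
End Form.

(** * Blowing up a framework *)

Section Blowup.
Variable R : realFieldType.

Lemma sum_sqr_mean (I : finType) (P : pred I) (s : I -> R) (t S : R) :
  #|P|%:R * S = \sum_(u | P u) s u ->
  \sum_(u | P u) (s u - t) ^+ 2 =
  #|P|%:R * (S - t) ^+ 2 + \sum_(u | P u) (s u - S) ^+ 2.
Proof.
move=> mS.
have -> : \sum_(u | P u) (s u - t) ^+ 2 = \sum_(u | P u) ((S - t) ^+ 2 +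
    2 * (S - t) * (s u - S) + (s u - S) ^+ 2).
  by apply: eq_bigr => u _; ring.
rewrite !big_split /= -[X in _ + X + _]mulr_sumr sumrB -mS !sumr_const.
by rewrite -[S *+ _]mulr_natl subrr mulr0 addr0 -[in LHS]mulr_natl.
Qed.

Lemma dotvBl d (u v w : 'rV[R]_d) : dotv (u - v) w = dotv u w - dotv v w.
Proof.
by rewrite /dotv -sumrB; apply: eq_bigr => i _; rewrite !mxE mulrBl.
Qed.

Lemma dotv_suml d (I : finType) (P : pred I) (x : I -> 'rV[R]_d) w :
  dotv (\sum_(u | P u) x u) w = \sum_(u | P u) dotv (x u) w.
Proof.
rewrite /dotv exchange_big; apply: eq_bigr => i _.
by rewrite summxE mulr_suml.
Qed.

Lemma dotvZl d a (u w : 'rV[R]_d) : dotv (a *: u) w = a * dotv u w.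
Proof.
by rewrite /dotv mulr_sumr; apply: eq_bigr => i _; rewrite !mxE mulrA.
Qed.

Definition mean d (I : finType) (P : pred I) (x : I -> 'rV[R]_d) : 'rV[R]_d :=
  #|P|%:R^-1 *: \sum_(u | P u) x u.

Lemma dotv_mean d (I : finType) (P : pred I) (x : I -> 'rV[R]_d) w :
  (0 < #|P|)%N -> #|P|%:R * dotv (mean P x) w = \sum_(u | P u) dotv (x u) w.
Proof.
move=> P0; rewrite /mean dotvZl mulrA mulfV ?mul1r ?dotv_suml //.
by rewrite pnatr_eq0 -lt0n.
Qed.

Lemma sum_norm_mean d (I : finType) (P : pred I) (x : I -> 'rV[R]_d) :
  (0 < #|P|)%N ->
  \sum_(u | P u) dotv (x u) (x u) = #|P|%:R * dotv (mean P x) (mean P x) +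
    \sum_(u | P u) dotv (x u - mean P x) (x u - mean P x).
Proof.
move=> P0; rewrite /dotv exchange_big [X in _ + X]exchange_big mulr_sumr -big_split.
apply: eq_bigr => i _ /=.
transitivity (\sum_(u | P u) (x u 0 i - 0) ^+ 2).
  by apply: eq_bigr => u _; rewrite subr0 expr2.
rewrite (@sum_sqr_mean _ P _ _ (mean P x 0 i)).
  rewrite subr0 expr2; congr (_ + _); apply: eq_bigr => u _.
  by rewrite [(x u - mean P x) 0 i]mxE [(- mean P x) 0 i]mxE expr2.
rewrite /mean !mxE summxE mulrA mulfV ?mul1r //.
by rewrite pnatr_eq0 -lt0n.
Qed.

(** Bars between two classes placed at two points all have the same direction,
    so only the scalars dotv (x u) w and dotv (y v) w matter, and the identity
    is the parallel axis theorem applied on both sides. *)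
Lemma sum_stretch d (I J : finType) (P : pred I) (Q : pred J)
    (x : I -> 'rV[R]_d) (y : J -> 'rV[R]_d) w :
  (0 < #|P|)%N -> (0 < #|Q|)%N ->
  \sum_(u | P u) \sum_(v | Q v) dotv (x u - y v) w ^+ 2 =
  #|P|%:R * #|Q|%:R * dotv (mean P x - mean Q y) w ^+ 2 +
  (#|Q|%:R * \sum_(u | P u) dotv (x u - mean P x) w ^+ 2 +
   #|P|%:R * \sum_(v | Q v) dotv (y v - mean Q y) w ^+ 2).
Proof.
move=> P0 Q0; pose X := dotv (mean P x) w; pose Y := dotv (mean Q y) w.
have -> : \sum_(u | P u) \sum_(v | Q v) dotv (x u - y v) w ^+ 2 =
  \sum_(u | P u) (#|Q|%:R * (dotv (x u) w - Y) ^+ 2 +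
     \sum_(v | Q v) (dotv (y v) w - Y) ^+ 2).
  apply: eq_bigr => u _.
  under eq_bigr => v _ do rewrite dotvBl -sqrrN opprB.
  rewrite (@sum_sqr_mean _ _ (fun v => dotv (y v) w) _ Y) ?dotv_mean //.
  by rewrite -sqrrN opprB.
rewrite big_split /= -mulr_sumr sumr_const -[_ *+ #|P|]mulr_natl.
rewrite (@sum_sqr_mean _ _ (fun u => dotv (x u) w) _ X) ?dotv_mean //.
rewrite mulrDr mulrA [#|Q|%:R * #|P|%:R]mulrC -addrA !dotvBl.
by congr (_ + (_ * _ + _ * _)); apply: eq_bigr => v _; rewrite dotvBl.
Qed.

Section Classes.
Variables (d : nat) (I J K : finType) (f : I -> K) (g : J -> K).
Variables (D : K -> K -> 'rV[R]_d) (x : I -> 'rV[R]_d) (y : J -> 'rV[R]_d).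
Variables (c0 c qI qJ : R).

Let P a := [pred u | f u == a].
Let Q b := [pred v | g v == b].
Let X a := mean (P a) x.
Let Y b := mean (Q b) y.

(** qI and qJ bound the class sizes from below.  Class means enter the norm
    with weight equal to the class size but gain only qI * qJ * c0, whence the
    two upper bounds on the class sizes; deviations in one side are held by at
    least qJ (resp. qI) copies of each bar. *)
Lemma blowup_stretch :
  (forall a, 0 < #|P a|)%N -> (forall b, 0 < #|Q b|)%N ->
  0 <= qI -> 0 <= qJ ->
  (forall a, qI <= #|P a|%:R) -> (forall b, qJ <= #|Q b|%:R) ->
  c <= qI * c0 -> c <= qJ * c0 ->
  (forall a, c * #|P a|%:R <= qI * qJ * c0) ->
  (forall b, c * #|Q b|%:R <= qI * qJ * c0) ->
  c0 * (\sum_a dotv (X a) (X a) + \sum_b dotv (Y b) (Y b)) <=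
    \sum_a \sum_b dotv (X a - Y b) (D a b) ^+ 2 ->
  (forall a z, c0 * dotv z z <= \sum_b dotv z (D a b) ^+ 2) ->
  (forall b z, c0 * dotv z z <= \sum_a dotv z (D a b) ^+ 2) ->
  c * (\sum_u dotv (x u) (x u) + \sum_v dotv (y v) (y v)) <=
    \sum_u \sum_v dotv (x u - y v) (D (f u) (g v)) ^+ 2.
Proof.
move=> P0 Q0 qI0 qJ0 qP qQ cI cJ cP cQ core blkI blkJ.
have dotv_ge0 (z : 'rV[R]_d) : 0 <= dotv z z.
  by apply: sumr_ge0 => i _; rewrite -expr2 sqr_ge0.
have -> : \sum_u \sum_v dotv (x u - y v) (D (f u) (g v)) ^+ 2 =
   \sum_a \sum_b \sum_(u | P a u) \sum_(v | Q b v) dotv (x u - y v) (D a b) ^+ 2.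
  rewrite (partition_big f xpredT) //=; apply: eq_bigr => a _.
  rewrite [RHS]exchange_big; apply: eq_bigr => u /eqP ->.
  rewrite (partition_big g xpredT) //=; apply: eq_bigr => b _.
  by apply: eq_bigr => v /eqP ->.
rewrite (partition_big f xpredT) //= [X in _ + X](partition_big g xpredT) //=.
under eq_bigr => a _ do rewrite (sum_norm_mean _ (P0 a)) -/(X a).
under [X in _ * (_ + X)]eq_bigr => b _ do rewrite (sum_norm_mean _ (Q0 b)) -/(Y b).
under [leRHS]eq_bigr => a _ do under eq_bigr => b _ do
  rewrite (sum_stretch _ _ _ (P0 a) (Q0 b)) -/(X a) -/(Y b).
under [leRHS]eq_bigr => a _ do rewrite !big_split /=.
rewrite !big_split /= addrACA mulrDr.
have hcore : c * (\sum_a #|P a|%:R * dotv (X a) (X a) +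
    \sum_b #|Q b|%:R * dotv (Y b) (Y b)) <=
  \sum_a \sum_b #|P a|%:R * #|Q b|%:R * dotv (X a - Y b) (D a b) ^+ 2.
  apply: (@le_trans _ _ (qI * qJ * (c0 * (\sum_a dotv (X a) (X a) +
      \sum_b dotv (Y b) (Y b))))).
    rewrite mulrA !mulrDr !mulr_sumr; apply: lerD; apply: ler_sum => a _;
      by rewrite mulrA ler_wpM2r.
  apply: le_trans (ler_wpM2l _ core) _; first exact: mulr_ge0.
  rewrite mulr_sumr; apply: ler_sum => a _; rewrite mulr_sumr; apply: ler_sum => b _.
  by rewrite ler_wpM2r ?sqr_ge0 // ler_pM.
apply: lerD => //; rewrite mulrDr; apply: lerD.
- rewrite mulr_sumr; apply: ler_sum => a _.
  under [leRHS]eq_bigr => b _ do rewrite mulr_sumr.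
  rewrite [leRHS]exchange_big mulr_sumr; apply: ler_sum => u _ /=.
  apply: (@le_trans _ _ (qJ * (c0 * dotv (x u - X a) (x u - X a)))).
    by rewrite mulrA ler_wpM2r.
  apply: le_trans (ler_wpM2l qJ0 (blkI a _)) _.
  by rewrite mulr_sumr; apply: ler_sum => b _; apply: ler_wpM2r; [exact: sqr_ge0 | exact: qQ].
- rewrite [leRHS]exchange_big mulr_sumr; apply: ler_sum => b _ /=.
  under [leRHS]eq_bigr => a _ do rewrite mulr_sumr.
  rewrite [leRHS]exchange_big mulr_sumr; apply: ler_sum => v _ /=.
  apply: (@le_trans _ _ (qI * (c0 * dotv (y v - Y b) (y v - Y b)))).
    by rewrite mulrA ler_wpM2r.
  apply: le_trans (ler_wpM2l qI0 (blkJ b _)) _.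
  by rewrite mulr_sumr; apply: ler_sum => a _; apply: ler_wpM2r; [exact: sqr_ge0 | exact: qP].
Qed.
End Classes.
End Blowup.

(** * Integer certificates for bounds on quadratic forms *)

(** A quadratic form is stored as the list of the rows of its upper triangle,
    each starting at the diagonal.  Missing entries count as zero, so addition
    needs no condition on shapes. *)
Fixpoint add_row (l l' : seq Z) : seq Z :=
  match l, l' with
  | [::], _ => l'
  | _, [::] => l
  | a :: t, a' :: t' => Z.add a a' :: add_row t t'
  end.

Fixpoint add_rows (M M' : seq (seq Z)) : seq (seq Z) :=
  match M, M' with
  | [::], _ => M'
  | _, [::] => M
  | r :: t, r' :: t' => add_row r r' :: add_rows t t'
  end.

Fixpoint square_rows (w : Z) (l : seq Z) : seq (seq Z) :=
  if l is a :: t then [seq Z.mul w (Z.mul a b) | b <- l] :: square_rows w t else [::].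

(** The entry - b c / a of the Schur complement with pivot a, rounded down. *)
Definition pivot_entry (a b c : Z) : Z := Z.div (Z.opp (Z.mul b c)) a.

(** The rounded correction - b b^T / a of the Schur complement, lowered by n on
    the diagonal.  Each off-diagonal rounding error is at most 1 and costs at
    most 1 on two diagonal entries, so for b of size n the lowering makes this
    form at most the exact correction. *)
Fixpoint pivot_update (a : Z) (n : nat) (b : seq Z) : seq (seq Z) :=
  if b is e :: t then
    (Z.sub (pivot_entry a e e) (Z.of_nat n) :: [seq pivot_entry a e c | c <- t]) :: pivot_update a n t
  else [::].

(** Gaussian elimination with positive pivots.  Rounding at each step keeps the
    entries at their initial size, where exact elimination would let them grow
    with the number of steps. *)
Fixpoint eliminates (n : nat) (M : seq (seq Z)) : bool :=
  if n is n'.+1 then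
    if M is (a :: b) :: M' then
      [&& Z.ltb 0 a, size b == n' & eliminates n' (add_rows M' (pivot_update a n' b))]
    else false
  else true.

(** Tests that the weighted sum of squares of the linear forms in F, minus c
    times the sum of the squares of the n variables, is positive. *)
Definition certifies (n : nat) (c : Z) (F : seq (Z * seq Z)) : bool :=
  eliminates n (foldr (fun wl => add_rows (square_rows wl.1 wl.2)) (nseq n [:: Z.opp c]) F).

Section Sound.
Variable R : realFieldType.

Definition zR (z : Z) : R := (int_of_Z z)%:~R.

Lemma zRD a b : zR (Z.add a b) = zR a + zR b.
Proof. by rewrite /zR (raddfD int_of_Z) rmorphD. Qed.
Lemma zRM a b : zR (Z.mul a b) = zR a * zR b.
Proof. by rewrite /zR (rmorphM int_of_Z) rmorphM. Qed.
Lemma zRN a : zR (Z.opp a) = - zR a.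
Proof. by rewrite /zR (raddfN int_of_Z) rmorphN. Qed.
Lemma zRB a b : zR (Z.sub a b) = zR a - zR b.
Proof. by rewrite zRD zRN. Qed.
Lemma zR0 : zR Z0 = 0. Proof. by []. Qed.
Lemma zR_nat n : zR (Z.of_nat n) = n%:R.
Proof. by rewrite /zR; have -> : int_of_Z (Z.of_nat n) = n%:Z by lia. Qed.
Lemma zR_le a b : Z.le a b -> zR a <= zR b.
Proof. by move=> ab; rewrite /zR ler_int; lia. Qed.
Lemma zR_lt a b : Z.lt a b -> zR a < zR b.
Proof. by move=> ab; rewrite /zR ltr_int; lia. Qed.

Fixpoint zdot (l : seq Z) (xs : seq R) : R :=
  match l, xs with a :: t, x :: ys => zR a * x + zdot t ys | _, _ => 0 end.

Definition zrow (r : seq Z) (x : R) (ys : seq R) : R :=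
  if r is a :: b then zR a * x ^+ 2 + 2 * x * zdot b ys else 0.

Fixpoint zform (M : seq (seq Z)) (xs : seq R) : R :=
  match M, xs with r :: t, x :: ys => zrow r x ys + zform t ys | _, _ => 0 end.

Definition sumsq (xs : seq R) : R := \sum_(x <- xs) x ^+ 2.

Lemma zdot_add l l' xs : zdot (add_row l l') xs = zdot l xs + zdot l' xs.
Proof.
elim: l l' xs => [|a l IH] [|a' l'] [|x xs] /=; rewrite ?add0r ?addr0 //.
by rewrite zRD IH; ring.
Qed.

Lemma zform_add M M' xs : zform (add_rows M M') xs = zform M xs + zform M' xs.
Proof.
elim: M M' xs => [|r M IH] [|r' M'] [|x xs] /=; rewrite ?add0r ?addr0 //.
rewrite IH addrACA; congr (_ + _).
by case: r r' => [|a r] [|a' r'] /=; rewrite ?add0r ?addr0 // zRD zdot_add; ring.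
Qed.

Lemma zdot_map (h : Z -> Z) k l xs :
  (forall a, zR (h a) = k * zR a) -> zdot [seq h a | a <- l] xs = k * zdot l xs.
Proof.
move=> hk; elim: l xs => [|a l IH] [|x xs] /=; rewrite ?mulr0 //.
by rewrite IH hk; ring.
Qed.

Lemma zform_square w l xs : zform (square_rows w l) xs = zR w * zdot l xs ^+ 2.
Proof.
elim: l xs => [|a l IH] [|x xs] /=; rewrite ?expr0n ?mulr0 //.
rewrite IH (@zdot_map _ (zR w * zR a)) => [|b]; rewrite !zRM; ring.
Qed.

Lemma zform_diag c xs : zform (nseq (size xs) [:: c]) xs = zR c * sumsq xs.
Proof.
elim: xs => [|x xs IH] /=; first by rewrite /sumsq big_nil mulr0.
by rewrite IH /sumsq big_cons; ring.
Qed.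

Lemma pivot_entryP a b c : Z.lt 0 a ->
  exists2 e, 0 <= e <= 1 & zR (pivot_entry a b c) = - (zR b * zR c / zR a) - e.
Proof.
move=> a0; have a0' := zR_lt a0; rewrite zR0 in a0'.
have E : Z.opp (Z.mul b c) = Z.add (Z.mul a (pivot_entry a b c)) (Z.modulo (Z.opp (Z.mul b c)) a).
  by apply: Z_div_mod_eq_full.
have [m0 m1] := Z.mod_pos_bound (Z.opp (Z.mul b c)) a a0.
set r := Z.modulo _ _ in E m0 m1.
exists (zR r / zR a).
  have := zR_le m0; have := zR_lt m1; rewrite zR0 => r1 r0.
  by rewrite divr_ge0 ?(ltW a0') //= ler_pdivrMr // mul1r ltW.
have := congr1 (@zR) E; rewrite zRN zRD !zRM => E'.
have a1 : zR a != 0 by rewrite gt_eqF.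
apply: (mulfI a1).
have -> : zR a * (- (zR b * zR c / zR a) - zR r / zR a) =
  - (zR b * zR c) - zR r by field.
by rewrite E'; ring.
Qed.

(** Each rounding error r in [0, 1] contributes - 2 r x y, at most
    x^2 + y^2. *)
Lemma rounding_loss a e x b ys : Z.lt 0 a -> size b = size ys ->
  2 * x * (zdot [seq pivot_entry a e c | c <- b] ys + zR e * zdot b ys / zR a) <=
  (size b)%:R * x ^+ 2 + sumsq ys.
Proof.
move=> a0; elim: b ys => [|c b IH] [|y ys] //=.
  by rewrite /sumsq big_nil; lra.
case=> /IH {}IH; have [r /andP[r0 r1] ->] := pivot_entryP e c a0.
rewrite /sumsq big_cons -/(sumsq _) -natr1.
have : - 2 * x * (r * y) <= x ^+ 2 + y ^+ 2.
  have ry : (r * y) ^+ 2 <= y ^+ 2 by rewrite exprMn ler_piMl ?sqr_ge0 ?exprn_ile1.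
  by have := sqr_ge0 (x + r * y); rewrite sqrrD -mulr_natr; lra.
have -> : zR e * (zR c * y + zdot b ys) / zR a =
    zR e * zR c / zR a * y + zR e * zdot b ys / zR a by ring.
move: IH; set u := zdot _ _; set v := _ / zR a; set w := _ / zR a; lra.
Qed.

Lemma pivot_update_le a n b ys : Z.lt 0 a -> size b = size ys ->
  zform (pivot_update a n b) ys + zdot b ys ^+ 2 / zR a <=
  ((size b)%:R - n%:R) * sumsq ys.
Proof.
move=> a0; elim: b ys => [|e b IH] [|y ys] //=.
  by rewrite /sumsq big_nil; lra.
case=> szE; have {}IH := IH _ szE; have loss := rounding_loss e y a0 szE.
have [r /andP[r0 r1] eE] := pivot_entryP e e a0.
rewrite /sumsq big_cons -/(sumsq _) zRB eE zR_nat -natr1.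
have -> : (zR e * y + zdot b ys) ^+ 2 / zR a = zR e * zR e / zR a * y ^+ 2 +
   2 * y * (zR e * zdot b ys / zR a) + zdot b ys ^+ 2 / zR a by ring.
have : 0 <= y ^+ 2 := sqr_ge0 y.
have : 0 <= r * y ^+ 2 by rewrite mulr_ge0 ?sqr_ge0.
move: IH loss; set u := zdot _ _; set v := _ / zR a; set w := _ / zR a.
set s := _ / zR a; set Y := sumsq ys.
rewrite !mulrBl !mulrDl !mulrDr; lra.
Qed.

(** Completing the square: a x^2 + 2 x s = (a x + s)^2 / a - s^2 / a, and the
    rounded update accounts for - s^2 / a. *)
Lemma eliminates_sound n M xs : size xs = n -> eliminates n M -> 0 <= zform M xs.
Proof.
elim: n M xs => [|n IH] M [|x xs] //=; first by case: M.
case=> sz; case: M => [|[|a b] M] //= /and3P[/Z.ltb_lt a0 /eqP szb] /(IH _ _ sz).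
rewrite zform_add => h; have a0' := zR_lt a0; rewrite zR0 in a0'.
have := pivot_update_le n a0 (etrans szb (esym sz)); rewrite szb subrr mul0r => h'.
have -> : zR a * x ^+ 2 + 2 * x * zdot b xs =
   (zR a * x + zdot b xs) ^+ 2 / zR a - zdot b xs ^+ 2 / zR a.
  by field; rewrite gt_eqF.
have : 0 <= (zR a * x + zdot b xs) ^+ 2 / zR a by rewrite divr_ge0 ?sqr_ge0 ?ltW.
lra.
Qed.

Lemma certifies_sound n c F xs : size xs = n -> certifies n c F ->
  zR c * sumsq xs <= \sum_(wl <- F) zR wl.1 * zdot wl.2 xs ^+ 2.
Proof.
move=> sz /(eliminates_sound sz).
suff -> : zform (foldr (fun wl => add_rows (square_rows wl.1 wl.2)) (nseq n [:: Z.opp c]) F) xs =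
   \sum_(wl <- F) zR wl.1 * zdot wl.2 xs ^+ 2 - zR c * sumsq xs by rewrite subr_ge0.
elim: F => [|wl F IH] /=; first by rewrite -sz zform_diag big_nil zRN; ring.
by rewrite zform_add IH big_cons zform_square addrA.
Qed.
End Sound.

(** * Certified frameworks with six sites on each side *)

Definition zsub (u v : seq Z) : seq Z := [seq Z.sub ab.1 ab.2 | ab <- zip u v].

Definition znorm2 (v : seq Z) : Z :=
  foldr (fun a s => Z.add (Z.mul a a) s) Z0 v.

(** Bars are weighted by D / |v|^2 rounded down, D being a common scale; for
    v = 0 the quotient is 0 by convention, as is the stretch of such a bar. *)
Definition weight (D : Z) (v : seq Z) : Z := Z.div D (znorm2 v).

Definition block (d a : nat) (v : seq Z) : seq Z :=
  flatten [seq if c == a then v else nseq d Z0 | c <- iota 0 6].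

Definition bar_vec (A B : seq (seq Z)) (a b : nat) : seq Z :=
  zsub (nth [::] A a) (nth [::] B b).

Definition bar_forms (d : nat) (D : Z) (A B : seq (seq Z)) : seq (Z * seq Z) :=
  [seq (weight D (bar_vec A B a b),
        block d a (bar_vec A B a b) ++ block d b [seq Z.opp e | e <- bar_vec A B a b])
  | a <- iota 0 6, b <- iota 0 6].

(** The values at p of a basis of the infinitesimal isometries: the translation
    along coordinate i for the index (i, i), and the rotation in the plane of
    coordinates i < j for the index (i, j). *)
Definition motion (d : nat) (ij : nat * nat) (p : seq Z) : seq Z :=
  [seq if ij.1 == ij.2 then if k == ij.1 then Zpos xH else Z0
       else if k == ij.1 then nth Z0 p ij.2
       else if k == ij.2 then Z.opp (nth Z0 p ij.1) else Z0 | k <- iota 0 d].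

Definition motions (d : nat) : seq (nat * nat) :=
  [seq (i, j) | i <- iota 0 d, j <- iota i (d - i)].

(** Pairing a displacement with an infinitesimal isometry gives a linear form
    that vanishes on the subspace of interest.  Adding the squares of these
    forms makes the total form definite; the weights kt and kr put the
    translations and rotations well above the threshold. *)
Definition pin_forms (d : nat) (kt kr : Z) (A B : seq (seq Z)) :=
  [seq (if ij.1 == ij.2 then kt else kr,
        flatten [seq motion d ij (nth [::] A c) | c <- iota 0 6] ++
        flatten [seq motion d ij (nth [::] B c) | c <- iota 0 6])
  | ij <- motions d].

(** The first certificate concerns the whole framework, with its 6 d + 6 d
    coordinates; the others the bars at each single site.  The bound obtained
    is c / D, because of the scale D of the weights. *)
Definition certified (d : nat) (D kt kr c : Z) (A B : seq (seq Z)) : bool :=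
  [&& Z.ltb 0 D, size (motions d) == 'C(d.+1, 2),
      all (fun a => size (nth [::] A a) == d) (iota 0 6),
      all (fun b => size (nth [::] B b) == d) (iota 0 6),
      certifies (6 * d + 6 * d) c (bar_forms d D A B ++ pin_forms d kt kr A B),
      all (fun a => certifies d c
             [seq (weight D (bar_vec A B a b), bar_vec A B a b) | b <- iota 0 6])
          (iota 0 6) &
      all (fun b => certifies d c
             [seq (weight D (bar_vec A B a b), bar_vec A B a b) | a <- iota 0 6])
          (iota 0 6)].

Section Certified.
Variables (R : realType) (d : nat).

Definition vecZ (l : seq Z) : 'rV[R]_d := \row_i zR R (nth Z0 l i).
Definition coords (x : 'rV[R]_d) : seq R := [seq x 0 i | i <- enum 'I_d].

Lemma size_coords x : size (coords x) = d.
Proof. by rewrite size_map size_enum_ord. Qed.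

Lemma sumsq_coords x : sumsq (coords x) = dotv x x.
Proof.
by rewrite /sumsq big_map big_enum; apply: eq_bigr => i _; rewrite expr2.
Qed.

Lemma sumsq_cat (xs ys : seq R) : sumsq (xs ++ ys) = sumsq xs + sumsq ys.
Proof. by rewrite /sumsq big_cat. Qed.

Lemma sumsq_flatten (s : seq nat) (g : nat -> seq R) :
  sumsq (flatten [seq g c | c <- s]) = \sum_(c <- s) sumsq (g c).
Proof.
elim: s => [|c s IH] /=; first by rewrite /sumsq !big_nil.
by rewrite sumsq_cat IH big_cons.
Qed.

Lemma zdotE (l : seq Z) (xs : seq R) : size l = size xs ->
  zdot l xs = \sum_(0 <= i < size xs) zR R (nth Z0 l i) * nth 0 xs i.
Proof.
elim: l xs => [|a l IH] [|x xs] //=; first by rewrite big_geq.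
by case=> /IH ->; rewrite big_nat_recl.
Qed.

Lemma zdot_coords l x : size l = d -> zdot l (coords x) = dotv x (vecZ l).
Proof.
move=> sz; rewrite zdotE ?size_coords // big_mkord; apply: eq_bigr => i _.
by rewrite mxE mulrC (nth_map i) ?size_enum_ord // nth_ord_enum.
Qed.

Lemma zdot_cat (l l' : seq Z) (xs ys : seq R) : size l = size xs ->
  zdot (l ++ l') (xs ++ ys) = zdot l xs + zdot l' ys.
Proof.
elim: l xs => [|a l IH] [|x xs] //=; first by rewrite add0r.
by case=> /IH ->; rewrite addrA.
Qed.

Lemma size_flatten_const T (s : seq nat) (g : nat -> seq T) :
  (forall c, c \in s -> size (g c) = d) ->
  size (flatten [seq g c | c <- s]) = (size s * d)%N.
Proof.
elim: s => //= c s IH gd; rewrite size_cat gd ?mem_head // IH ?mulSn //.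
by move=> e es; apply: gd; rewrite inE es orbT.
Qed.

Lemma zdot_flatten (s : seq nat) (fs : nat -> seq Z) (x : nat -> 'rV[R]_d) :
  (forall c, c \in s -> size (fs c) = d) ->
  zdot (flatten [seq fs c | c <- s]) (flatten [seq coords (x c) | c <- s]) =
  \sum_(c <- s) dotv (x c) (vecZ (fs c)).
Proof.
elim: s => [|c s IH] fd; first by rewrite big_nil.
rewrite /= zdot_cat ?size_coords ?fd ?mem_head // big_cons.
rewrite zdot_coords ?fd ?mem_head // IH // => e es.
by apply: fd; rewrite inE es orbT.
Qed.

Lemma dotv0 (x : 'rV[R]_d) : dotv x (vecZ (nseq d Z0)) = 0.
Proof.
rewrite /dotv big1 // => i _.
by rewrite mxE nth_nseq if_same mulr0.
Qed.

Lemma zdot_block a v (x : nat -> 'rV[R]_d) : (a < 6)%N -> size v = d ->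
  zdot (block d a v) (flatten [seq coords (x c) | c <- iota 0 6]) =
  dotv (x a) (vecZ v).
Proof.
move=> a6 sz; rewrite (@zdot_flatten _ (fun c => if c == a then v else nseq d Z0)).
  rewrite (bigD1_seq a) ?iota_uniq ?mem_iota //= eqxx big1 ?addr0 // => c /negPf ->.
  exact: dotv0.
by move=> c _; case: eqP => _; rewrite ?size_nseq.
Qed.

Lemma vecZ_sub u v : size u = d -> size v = d ->
  vecZ (zsub u v) = vecZ u - vecZ v.
Proof.
move=> su sv; apply/rowP => i; rewrite !mxE.
rewrite (nth_map (Z0, Z0)) ?size_zip ?su ?sv ?minnn // nth_zip ?su ?sv //=.
by rewrite zRB.
Qed.

Lemma vecZ_opp v : size v = d -> vecZ [seq Z.opp e | e <- v] = - vecZ v.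
Proof.
by move=> sv; apply/rowP => i; rewrite !mxE (nth_map Z0) ?sv // zRN.
Qed.

Lemma dotvN (x y : 'rV[R]_d) : dotv x (- y) = - dotv x y.
Proof.
by rewrite /dotv -sumrN; apply: eq_bigr => i _; rewrite !mxE mulrN.
Qed.

Lemma zR_norm2 v : size v = d -> zR R (znorm2 v) = dotv (vecZ v) (vecZ v).
Proof.
move=> sv; transitivity (\sum_(e <- v) zR R e * zR R e).
  elim: v {sv} => [|e v IH]; first by rewrite big_nil.
  by rewrite big_cons /= zRD zRM IH.
by rewrite (big_nth Z0) sv big_mkord; apply: eq_bigr => i _; rewrite mxE.
Qed.

Lemma weight_le D v (x : 'rV[R]_d) : Z.lt 0 D -> size v = d ->
  zR R (weight D v) * dotv x (vecZ v) ^+ 2 <=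
  zR R D * (dotv x (vecZ v) ^+ 2 / dotv (vecZ v) (vecZ v)).
Proof.
move=> D0 sv; rewrite mulrC [leRHS]mulrCA -(zR_norm2 sv); apply: ler_wpM2l; first exact: sqr_ge0.
have v0 : zR R Z0 <= zR R (znorm2 v).
  rewrite zR_norm2 // zR0; apply: sumr_ge0 => i _; rewrite -expr2; exact: sqr_ge0.
rewrite /weight; have [E|N] := Z.eq_dec (znorm2 v) Z0.
  by rewrite E Zdiv.Zdiv_0_r zR0 invr0 mulr0.
have v1 : Z.lt Z0 (znorm2 v).
  by move: v0; rewrite /zR ler_int => v0; lia.
have v1' := zR_lt R v1; rewrite zR0 in v1'.
rewrite ler_pdivlMr // mulrC -zRM; apply: zR_le; exact: Z.mul_div_le.
Qed.

Variables (D kt kr c : Z) (A B : seq (seq Z)).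
Hypothesis cert : certified d D kt kr c A B.

Lemma certified_scale : Z.lt 0 D.
Proof. by case/and4P: cert => /Z.ltb_lt. Qed.

Lemma sizeA a : (a < 6)%N -> size (nth [::] A a) = d.
Proof.
move=> a6; case/and4P: cert => _ _ /allP/(_ a) hA _.
by apply/eqP/hA; rewrite mem_iota.
Qed.

Lemma sizeB b : (b < 6)%N -> size (nth [::] B b) = d.
Proof.
move=> b6; case/and5P: cert => _ _ _ /allP/(_ b) hB _.
by apply/eqP/hB; rewrite mem_iota.
Qed.

Lemma size_bar_vec a b : (a < 6)%N -> (b < 6)%N -> size (bar_vec A B a b) = d.
Proof. by move=> a6 b6; rewrite size_map size_zip sizeA // sizeB // minnn. Qed.

Definition site : 'I_6 + 'I_6 -> 'rV[R]_d := fun s =>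
  match s with
  | inl a => vecZ (nth [::] A a)
  | inr b => vecZ (nth [::] B b)
  end.

Lemma vecZ_bar_vec (a b : 'I_6) : vecZ (bar_vec A B a b) = site (inl a) - site (inr b).
Proof. by rewrite vecZ_sub ?sizeA ?sizeB. Qed.

Lemma weight_bar_le (a b : 'I_6) x :
  zR R (weight D (bar_vec A B a b)) * dotv x (vecZ (bar_vec A B a b)) ^+ 2 <=
  zR R D * dotv x (direction site (inl a) (inr b)) ^+ 2.
Proof.
rewrite dotv_direction -vecZ_bar_vec; apply: weight_le; first exact: certified_scale.
by rewrite size_bar_vec.
Qed.

Let D0 : 0 < zR R D.
Proof. by have := zR_lt R certified_scale; rewrite zR0. Qed.

Lemma certified_blockl (a : 'I_6) z :
  zR R c / zR R D * dotv z z <= \sum_b dotv z (direction site (inl a) (inr b)) ^+ 2.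
Proof.
case/and5P: cert => _ _ _ _ /and3P[_ /allP/(_ a) h _].
have {}h := certifies_sound (size_coords z) (h _); rewrite mulrAC ler_pdivrMr //.
rewrite sumsq_coords in h; apply: le_trans (h _) _; first by rewrite mem_iota /=.
rewrite big_map -[iota 0 6]/(index_iota 0 6) big_mkord mulr_suml.
apply: ler_sum => b _; rewrite zdot_coords ?size_bar_vec // [leRHS]mulrC.
exact: weight_bar_le.
Qed.

Lemma certified_blockr (b : 'I_6) z :
  zR R c / zR R D * dotv z z <= \sum_a dotv z (direction site (inl a) (inr b)) ^+ 2.
Proof.
case/and5P: cert => _ _ _ _ /and3P[_ _ /allP/(_ b) h].
have {}h := certifies_sound (size_coords z) (h _); rewrite mulrAC ler_pdivrMr //.
rewrite sumsq_coords in h; apply: le_trans (h _) _; first by rewrite mem_iota /=.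
rewrite big_map -[iota 0 6]/(index_iota 0 6) big_mkord mulr_suml.
apply: ler_sum => a _; rewrite zdot_coords ?size_bar_vec // [leRHS]mulrC.
exact: weight_bar_le.
Qed.

Definition site_motion (ij : nat * nat) (s : 'I_6 + 'I_6) : 'rV[R]_d :=
  match s with
  | inl a => vecZ (motion d ij (nth [::] A a))
  | inr b => vecZ (motion d ij (nth [::] B b))
  end.

Lemma certified_core (X Y : 'I_6 -> 'rV[R]_d) :
  (forall ij, ij \in motions d ->
    \sum_a dotv (X a) (site_motion ij (inl a)) +
    \sum_b dotv (Y b) (site_motion ij (inr b)) = 0) ->
  zR R c / zR R D * (\sum_a dotv (X a) (X a) + \sum_b dotv (Y b) (Y b)) <=
  \sum_a \sum_b dotv (X a - Y b) (direction site (inl a) (inr b)) ^+ 2.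
Proof.
move=> XY0; pose x i := X (inord i); pose y i := Y (inord i).
pose xs := flatten [seq coords (x i) | i <- iota 0 6].
pose ys := flatten [seq coords (y i) | i <- iota 0 6].
have sxs : size xs = (6 * d)%N.
  by rewrite (@size_flatten_const _ (iota 0 6)) // => i _; rewrite size_coords.
have sys : size ys = (6 * d)%N.
  by rewrite (@size_flatten_const _ (iota 0 6)) // => i _; rewrite size_coords.
have sz : size (xs ++ ys) = (6 * d + 6 * d)%N by rewrite size_cat sxs sys.
case/and5P: cert => _ _ _ _ /and3P[/(certifies_sound sz) h _ _].
have ord6 (F : nat -> R) : \sum_(i <- iota 0 6) F i = \sum_(i < 6) F i.
  by rewrite -[iota 0 6]/(index_iota 0 6) big_mkord.
have xE (a : 'I_6) : x a = X a by rewrite /x inord_val.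
have yE (b : 'I_6) : y b = Y b by rewrite /y inord_val.
rewrite sumsq_cat !sumsq_flatten !ord6 in h.
under eq_bigr => a _ do rewrite -xE -sumsq_coords.
under [X in _ * (_ + X)]eq_bigr => b _ do rewrite -yE -sumsq_coords.
rewrite mulrAC ler_pdivrMr //; apply: le_trans h _.
rewrite big_cat /= [X in _ + X]big_map [X in _ + X]big_seq.
rewrite [X in _ + X]big1 ?addr0 => [|ij ijP].
  rewrite /bar_forms big_allpairs_dep ord6 mulr_suml; apply: ler_sum => a _.
  rewrite ord6 mulr_suml; apply: ler_sum => b _ /=.
  have sb := size_bar_vec (ltn_ord a) (ltn_ord b).
  rewrite zdot_cat ?sxs; last first.
    rewrite (@size_flatten_const _ (iota 0 6)) // => i _.
    by case: eqP; rewrite ?size_nseq.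
  have sb' : size [seq Z.opp e | e <- bar_vec A B a b] = d by rewrite size_map.
  rewrite (zdot_block _ _ sb) // (zdot_block _ _ sb') // vecZ_opp // dotvN.
  rewrite -dotvBl xE yE [leRHS]mulrC; exact: weight_bar_le.
rewrite [zdot _ _](_ : _ = zdot (
    flatten [seq motion d ij (nth [::] A i) | i <- iota 0 6] ++
    flatten [seq motion d ij (nth [::] B i) | i <- iota 0 6]) (xs ++ ys)) //.
rewrite zdot_cat ?sxs; last first.
  by rewrite (@size_flatten_const _ (iota 0 6)) // => i _; rewrite size_map size_iota.
rewrite !(@zdot_flatten (iota 0 6)); try by move=> i _; rewrite size_map size_iota.
rewrite !ord6.
under eq_bigr => a _ do rewrite xE.
under [X in _ + X]eq_bigr => b _ do rewrite yE.
by rewrite XY0 // expr0n mulr0.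
Qed.
End Certified.

(** * Rounding, and the two frameworks *)

Definition class6 n (u : 'I_n) : 'I_6 := Ordinal (ltn_pmod u (isT : 0 < 6)%N).

Lemma class6_ge n (a : 'I_6) : (n %/ 6 <= #|[pred u : 'I_n | class6 u == a]|)%N.
Proof.
have lt (i : 'I_(n %/ 6)) : (i * 6 + a < n)%N by have := ltn_ord i; have := ltn_ord a; lia.
rewrite -[X in (X <= _)%N]card_ord -(@card_codom _ _ (fun i => Ordinal (lt i))).
  apply: subset_leq_card; apply/fintype.subsetP => _ /codomP[i ->].
  by rewrite inE -val_eqE /= modnMDl modn_small.
by move=> i j [] /eqP; rewrite eqn_add2r eqn_pmul2r // => /eqP/val_inj.
Qed.

Lemma class6_le n (a : 'I_6) :
  (#|[pred u : 'I_n | class6 u == a]| <= (n %/ 6).+1)%N.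
Proof.
rewrite -[X in (_ <= X)%N]card_ord.
have lt (u : 'I_n) : (u %/ 6 < (n %/ 6).+1)%N by have := ltn_ord u; lia.
apply: (@leq_card_in _ _ (fun u => Ordinal (lt u))) => u v.
rewrite !inE -!val_eqE /= => /eqP ua /eqP va [uv].
by apply: val_inj => /=; rewrite (divn_eq u 6) (divn_eq v 6) uv ua va.
Qed.

(** With 6 q - 5 = (6 q + 5) - 10, the case q <= s amounts to
    (6 q - 5) (q + 1) <= 6.05 q^2, that is 0.05 (q - 10)^2 >= 0; in the
    case s < q it remains that 6 s - 5 q - 5 <= 0.05 q s, which follows from
    s - 5 <= 0.05 s^2, that is 0.05 (s - 10)^2 >= 0. *)
Lemma rounding_budget (R : realFieldType) (q s t c0 c N : R) :
  1 <= q -> 1 <= s -> 0 <= t -> 605 / 100 * t <= c0 -> 0 <= N -> N <= q + 1 ->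
  c <= t * (6 * q - 5) -> c <= t * (6 * s - 5) -> c * N <= q * s * c0.
Proof.
move=> q1 s1 t0 tc N0 Nq cq cs.
have qs0 : 0 <= q * s by nra.
have c00 : 0 <= c0 by nra.
case: (lerP c 0) => [c0'|c0'].
  apply: (@le_trans _ _ 0); first by nra.
  exact: mulr_ge0.
apply: (@le_trans _ _ (c * (q + 1))); first by nra.
apply: (@le_trans _ _ (t * (q * s * (605 / 100)))); last first.
  by have := ler_wpM2l qs0 tc; nra.
have q10 : 0 <= q + 1 by lra.
case: (lerP q s) => qs.
  apply: (@le_trans _ _ (t * ((6 * q - 5) * (q + 1)))).
    by rewrite mulrA; apply: ler_wpM2r.
  apply: ler_wpM2l => //; have := sqr_ge0 (q - 10).
  have : q * q <= q * s by apply: ler_wpM2l => //; lra.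
  lra.
apply: (@le_trans _ _ (t * ((6 * s - 5) * (q + 1)))).
  by rewrite mulrA; apply: ler_wpM2r.
apply: ler_wpM2l => //.
have : s * s <= q * s by apply: ler_wpM2r; lra.
have := sqr_ge0 (s - 10); lra.
Qed.

Section Final.
Variables (R : realType) (d : nat) (D kt kr c : Z) (A B : seq (seq Z)).

(** The linear forms that cut out the subspace take class means before pairing
    with the infinitesimal isometries, hence the factors wt.  The constant
    t = tn / td is given by numerator and denominator so that the comparison
    605 / 100 * t <= c / D is a computation on integers. *)
Lemma certified_bound (n m tn td : nat) (t := tn%:R / td%:R : R) :
  certified d D kt kr c A B -> (10 < n)%N -> (10 < m)%N ->
  ('C(d.+1, 2) < (n + m) * d)%N -> (0 < td)%N ->
  Z.le (Z.mul (Z.mul (Z.of_nat 605) (Z.of_nat tn)) D)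
    (Z.mul (Z.mul (Z.of_nat 100) (Z.of_nat td)) c) ->
  t * ((minn n m)%:R - 10) <= alg_connectivity R d (complete_bipartite n m).
Proof.
move=> cert n10 m10 dof td0 tcZ; pose c0 := zR R c / zR R D.
have t0 : 0 <= t by apply: divr_ge0.
have tc : 605 / 100 * t <= c0.
  have D0 := zR_lt R (certified_scale cert); rewrite zR0 in D0.
  have td0' : 0 < td%:R :> R by rewrite ltr0n.
  have := zR_le R tcZ; rewrite !zRM !zR_nat => le.
  rewrite ler_pdivlMr // -(ler_pM2l (mulr_gt0 (ltr0n _ 100) td0')).
  apply: le_trans le; rewrite le_eqVlt; apply/orP; left; apply/eqP.
  by rewrite /t; field; rewrite gt_eqF.
pose cls (u : 'I_n + 'I_m) : 'I_6 + 'I_6 :=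
  match u with inl a => inl (class6 a) | inr b => inr (class6 b) end.
pose P (a : 'I_6) := [pred u : 'I_n | class6 u == a].
pose Q (b : 'I_6) := [pred v : 'I_m | class6 v == b].
have P0 a : (0 < #|P a|)%N by apply: leq_trans (class6_ge n a); lia.
have Q0 b : (0 < #|Q b|)%N by apply: leq_trans (class6_ge m b); lia.
pose wt (u : 'I_n + 'I_m) : R :=
  match u with inl a => #|P (class6 a)|%:R^-1 | inr b => #|Q (class6 b)|%:R^-1 end.
have szT : size (motions d) = 'C(d.+1, 2) by case/and3P: cert => _ /eqP.
pose T (j : 'I_('C(d.+1, 2))) u : 'rV[R]_d :=
  wt u *: site_motion R d A B (nth (0%N, 0%N) (motions d) j) (cls u).
apply: (@alg_connectivity_ge R d n m (fun u => site R d A B (cls u)) T) => // x xT.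
rewrite big_sumType /=.
pose qn : R := (n %/ 6)%:R; pose qm : R := (m %/ 6)%:R.
have qn1 : 1 <= qn by rewrite ler1n; lia.
have qm1 : 1 <= qm by rewrite ler1n; lia.
have nq : (minn n m)%:R <= 6 * qn + 5 :> R.
  by rewrite -natrM -natrD ler_nat; lia.
have mq : (minn n m)%:R <= 6 * qm + 5 :> R.
  by rewrite -natrM -natrD ler_nat; lia.
pose cc := t * ((minn n m)%:R - 10); rewrite -/cc.
have ccn : cc <= t * (6 * qn - 5) by rewrite ler_wpM2l //; lra.
have ccm : cc <= t * (6 * qm - 5) by rewrite ler_wpM2l //; lra.
have tle q : 1 <= q -> t * (6 * q - 5) <= q * c0 by move=> q1; nra.
apply: (@blowup_stretch R d _ _ _ (@class6 n) (@class6 m)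
  (fun a b => direction (site R d A B) (inl a) (inr b))
  (fun a => x (inl a)) (fun b => x (inr b)) c0 cc qn qm) => //; try lra.
- by move=> a; rewrite ler_nat class6_ge.
- by move=> b; rewrite ler_nat class6_ge.
- exact: le_trans ccn (tle _ qn1).
- exact: le_trans ccm (tle _ qm1).
- move=> a; apply: (@rounding_budget _ _ _ t) => //.
  by rewrite natr1 ler_nat class6_le.
- move=> b; rewrite [qn * _]mulrC; apply: (@rounding_budget _ _ _ t) => //.
  by rewrite natr1 ler_nat class6_le.
- apply: (@certified_core R d D kt kr c A B cert
    (fun a => mean (P a) (fun u => x (inl u)))
    (fun b => mean (Q b) (fun v => x (inr v)))) => ij ijT.
  have jlt : (index ij (motions d) < 'C(d.+1, 2))%N by rewrite -szT index_mem.
  have TE u : T (Ordinal jlt) u = wt u *: site_motion R d A B ij (cls u).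
    by rewrite /T nth_index.
  rewrite -[RHS](xT (Ordinal jlt)) [in RHS]big_sumType; congr (_ + _).
    rewrite [RHS](partition_big (@class6 n) xpredT) //; apply: eq_bigr => a _.
    rewrite /mean dotvZl dotv_suml mulr_sumr; apply: eq_bigr => u /eqP ua.
    rewrite TE [wt _]/= [cls _]/= ua.
    by rewrite /dotv mulr_sumr; apply: eq_bigr => i _; rewrite [in RHS]mxE mulrCA.
  rewrite [RHS](partition_big (@class6 m) xpredT) //; apply: eq_bigr => b _.
  rewrite /mean dotvZl dotv_suml mulr_sumr; apply: eq_bigr => v /eqP vb.
  rewrite TE [wt _]/= [cls _]/= vb.
  by rewrite /dotv mulr_sumr; apply: eq_bigr => i _; rewrite [in RHS]mxE mulrCA.
- by move=> a z; apply: certified_blockl cert a z.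
- by move=> b z; apply: certified_blockr cert b z.
Qed.
End Final.

(** Both frameworks come from a numerical maximization of the least nontrivial
    eigenvalue, rounded to integers.  The constant c0 is about 1.703 in the plane, where
    1.6819 is needed, and about 0.400 in space, where 0.37389 is needed.  The
    coordinates of the planar one are large because good planar frameworks
    have several scales: the sites form close pairs with one member on each
    side, some of these pairs are again close to each other, and each bar within
    a cluster then has a direction unrelated to the position of the
    cluster. *)
Section Frameworks.
Local Open Scope Z_scope.
Definition planar_A : seq (seq Z) :=
  [:: [:: 255; 17]; [:: 252; 12]; [:: -234; -30];
      [:: -35; -410]; [:: -235; -39]; [:: -58; -155]].
Definition planar_B : seq (seq Z) :=
  [:: [:: 252; 19]; [:: 254; 10]; [:: -237; -32];
      [:: -27; -408]; [:: -232; -37]; [:: -60; -158]].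
Definition spatial_A : seq (seq Z) :=
  [:: [:: -5; 5; 3]; [:: 1; 6; -4]; [:: -2; -1; -4];
      [:: -4; -4; 2]; [:: 3; -4; 2]; [:: 8; 3; 1]].
Definition spatial_B : seq (seq Z) :=
  [:: [:: -1; -2; 2]; [:: 4; 1; -2]; [:: 0; -6; 0];
      [:: -2; 2; -9]; [:: -4; 4; -1]; [:: 1; 5; 1]].
End Frameworks.

Lemma planar_certified :
  certified 2 100000000 100000000 1000 168190000 planar_A planar_B.
Proof. by vm_compute. Qed.

Lemma spatial_certified :
  certified 3 100000000 100000000 1000000 37389000 spatial_A spatial_B.
Proof. by vm_compute. Qed.

Theorem theorem1p5 (R : realType) (n m : nat)
    (hn : (10 < n)%N) (hm : (10 < m)%N) :
  alg_connectivity R 2 (complete_bipartite n m)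
    >= 278 / 1000 * (minn n m)%:R - 278 / 100
  /\ alg_connectivity R 3 (complete_bipartite n m)
    >= 618 / 10000 * (minn n m)%:R - 618 / 1000.
Proof.
have b2 := @certified_bound R 2 _ _ _ _ _ _ n m 278 1000 planar_certified hn hm.
have b3 := @certified_bound R 3 _ _ _ _ _ _ n m 618 10000 spatial_certified hn hm.
have budget (N a b e : R) : b = a * 10 -> a * (N - 10) <= e -> a * N - b <= e.
  by move=> -> ; rewrite -mulrBr.
split.
- apply: budget; first by field.
  by apply: b2; [rewrite -['C(_, _)]/3%N; lia | | vm_compute].
- apply: budget; first by field.
  by apply: b3; [rewrite -['C(_, _)]/6%N; lia | | vm_compute].
Qed.
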